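(* Let $K$ be a field. If the finitistic dimension of every algebra $K\mathcal{Q}/I$, with $\mathcal{Q}$ a path connected finite quiver and $I$ an admissible ideal of $K\mathcal{Q}$, is finite, then the finitistic dimension of every algebra $K\mathcal{Q}/I$ is finite, for all choices of a finite quiver $\mathcal{Q}$ and an admissible ideal $I$ of $K\mathcal{Q}$.
   Context: A quiver is path connected if for each pair of vertices $v,w$ there is both a directed path from $v$ to $w$ and a directed path from $w$ to $v$ in it. An ideal $I$ of the path algebra $K\mathcal{Q}$ is admissible if $J^n\subseteq I\subseteq J^2$ for some $n\ge 2$, where $J$ is the ideal generated by the arrows. The finitistic dimension of a finite dimensional algebra is the supremum of the projective dimensions of finitely generated (right) modules having finite projective dimension. *)

(* Defs.v *)
From HB Require Import structures.
From mathcomp Require Import all_boot all_order all_algebra ring_quotient.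
From mathcomp Require Import finmap monalg boolp classical_sets.

Set Implicit Arguments.
Unset Strict Implicit.
Unset Printing Implicit Defensive.

Import GRing.Theory.

Local Open Scope classical_set_scope.
Local Open Scope ring_scope.

Record quiver := Quiver {
  vertex : finType;
  arrow : finType;
  src : arrow -> vertex;
  tgt : arrow -> vertex
}.

Section Paths.
Variable Q : quiver.

Fixpoint walk (v : vertex Q) (s : seq (arrow Q)) : bool :=
  if s is a :: s' then (src a == v) && walk (tgt a) s' else true.

Definition walk_end (v : vertex Q) (s : seq (arrow Q)) : vertex Q :=
  foldl (fun _ a => tgt a) v s.

(* The start vertex is recorded so that each vertex has its own trivial path. *)
Record qpath := QPath {
  qpath_val : vertex Q * seq (arrow Q);
  _ : walk qpath_val.1 qpath_val.2
}.
HB.instance Definition _ := [isSub for qpath_val].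

(* Opaque, as unfolding these instances makes unification in the path algebra
   prohibitively slow. *)
Fact qpath_hasDecEq : hasDecEq qpath.
Proof. exact: (hasDecEq.Build qpath (inj_eqAxiom val_inj)). Qed.
HB.instance Definition _ := qpath_hasDecEq.

Fact qpath_hasChoice : hasChoice qpath.
Proof. exact: (PCanHasChoice (@valK _ _ qpath)). Qed.
HB.instance Definition _ := qpath_hasChoice.

Definition psrc (p : qpath) : vertex Q := (val p).1.
Definition parrows (p : qpath) : seq (arrow Q) := (val p).2.
Definition ptgt (p : qpath) : vertex Q := walk_end (psrc p) (parrows p).

Definition ptriv (v : vertex Q) : qpath := @QPath (v, [::]) isT.

Lemma parrow_proof (a : arrow Q) : walk (src a) [:: a].
Proof. by rewrite /= eqxx. Qed.

Definition parrow (a : arrow Q) : qpath :=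
  @QPath (src a, [:: a]) (parrow_proof a).

(* First [p], then [q]; [insub] returns [Some] whenever the endpoints match. *)
Definition pcomp (p q : qpath) : option qpath :=
  if ptgt p == psrc q then
    (insub (psrc p, parrows p ++ parrows q) : option qpath)
  else None.

Definition path_connected :=
  forall v w : vertex Q,
    (exists p : qpath, psrc p = v /\ ptgt p = w) /\
    (exists p : qpath, psrc p = w /\ ptgt p = v).

Lemma walk_cat v s t : walk v (s ++ t) = walk v s && walk (walk_end v s) t.
Proof. by elim: s v => //= a s IHs v; rewrite IHs andbA. Qed.

Lemma walk_end_cat v s t : walk_end v (s ++ t) = walk_end (walk_end v s) t.
Proof. exact: foldl_cat. Qed.

Variant pcomp_spec p q : option qpath -> Prop :=
| PcompSome r of ptgt p = psrc q & psrc r = psrc p & ptgt r = ptgt q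
    & parrows r = parrows p ++ parrows q : pcomp_spec p q (Some r)
| PcompNone of ptgt p <> psrc q : pcomp_spec p q None.

Lemma pcompP p q : pcomp_spec p q (pcomp p q).
Proof.
rewrite /pcomp; case: eqP => [pq|]; last by constructor.
case: insubP => [r _ vr|/=].
  by constructor; rewrite // /ptgt /psrc /parrows vr //= walk_end_cat
    -/(psrc p) -/(parrows p) -/(ptgt p) pq.
by rewrite walk_cat (valP p) -/(ptgt p) pq (valP q).
Qed.

Lemma qpath_eq p q : psrc p = psrc q -> parrows p = parrows q -> p = q.
Proof.
by move=> e1 e2; apply/val_inj; move: e1 e2; rewrite /psrc /parrows;
   case: (val p) (val q) => [? ?] [? ?] /= -> ->.
Qed.

Lemma pcompA p q r :
  obind (pcomp p) (pcomp q r) = obind (pcomp^~ r) (pcomp p q).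
Proof.
case: (pcompP q r) => [s qr s1 s2 s3|qr];
  case: (pcompP p q) => [t pq t1 t2 t3|pq] //=.
- case: (pcompP p s) => [u _ u1 u2 u3|]; last by rewrite s1.
  case: (pcompP t r) => [w _ w1 w2 w3|]; last by rewrite t2.
  by congr Some; apply: qpath_eq; rewrite ?u1 ?w1 // u3 w3 s3 t3 catA.
- by case: (pcompP p s) => //; rewrite s1.
- by case: (pcompP t r) => //; rewrite t2.
Qed.

Lemma pcomp_triv v p : pcomp (ptriv v) p = if v == psrc p then Some p else None.
Proof.
case: pcompP => [r e r1 _ r2|/eqP/negbTE]; last by rewrite [ptgt _]/= => ->.
have {}e : v = psrc p := e; rewrite -e eqxx; congr Some.
by apply: qpath_eq; rewrite ?r1.
Qed.

Lemma pcompp_triv v p :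
  pcomp p (ptriv v) = if v == ptgt p then Some p else None.
Proof.
case: pcompP => [r e r1 _ r2|/eqP/negbTE]; last by rewrite eq_sym => ->.
rewrite e eqxx; congr Some.
by apply: qpath_eq; rewrite ?r1 // r2 cats0.
Qed.

End Paths.

(* Plain rings ([pzRingType]) are used since the empty quiver gives 0 = 1. *)
Definition pathalg (K : fieldType) (Q : quiver) : Type := {malg K[qpath Q]}.
HB.instance Definition _ (K : fieldType) (Q : quiver) :=
  GRing.Lmodule.on (pathalg K Q).

HB.lock Definition pbasis (K : fieldType) (Q : quiver)
    (p : qpath Q) : pathalg K Q := << p >>.

HB.lock Definition pathalg_mul (K : fieldType) (Q : quiver)
    (f g : pathalg K Q) : pathalg K Q :=
  \sum_(p <- msupp f) \sum_(q <- msupp g)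
    (f@_p * g@_q) *: oapp (@pbasis K Q) 0 (pcomp p q).

Section PathAlgebra.
Variables (K : fieldType) (Q : quiver).
Implicit Types f g h : pathalg K Q.

Local Notation pathalg := (pathalg K Q).
Local Notation pbasis := (@pbasis K Q).
Local Notation pbasis_mul p q := (oapp pbasis 0 (pcomp p q)).

Definition pathalg_one : pathalg := \sum_(v : vertex Q) pbasis (ptriv v).

Local Notation mul := (@pathalg_mul K Q).

Lemma mcoeff_pbasis p q : (pbasis p)@_q = (p == q)%:R.
Proof. by rewrite pbasis.unlock mcoeffU. Qed.

Lemma msupp_pbasis p : (msupp (pbasis p) `<=` [fset p])%fset.
Proof. by rewrite pbasis.unlock msuppU_le. Qed.

Lemma pathalg_mulw (d1 d2 : {fset qpath Q}) f g :
  (msupp f `<=` d1)%fset -> (msupp g `<=` d2)%fset ->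
  mul f g = \sum_(p <- d1) \sum_(q <- d2) (f@_p * g@_q) *: pbasis_mul p q.
Proof.
move=> le1 le2; rewrite pathalg_mul.unlock (big_fset_incl _ le1) /=.
  apply/eq_bigr=> p _; apply/big_fset_incl => // q _ /mcoeff_outdom ->.
  by rewrite mulr0 scale0r.
move=> p _ /mcoeff_outdom f0; rewrite big1 // => q _.
by rewrite f0 mul0r scale0r.
Qed.

Lemma pathalg_mulDl : left_distributive mul +%R.
Proof.
move=> f g h.
rewrite (pathalg_mulw (msuppD_le f g) (fsubset_refl _)).
rewrite (pathalg_mulw (fsubsetUl (msupp f) (msupp g)) (fsubset_refl (msupp h))).
rewrite (pathalg_mulw (fsubsetUr (msupp f) (msupp g)) (fsubset_refl (msupp h))).
rewrite -big_split; apply: eq_bigr => p _; rewrite -big_split.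
by apply: eq_bigr => q _ /=; rewrite mcoeffD mulrDl scalerDl.
Qed.

Lemma pathalg_mulDr : right_distributive mul +%R.
Proof.
move=> h f g.
rewrite (pathalg_mulw (fsubset_refl _) (msuppD_le f g)).
rewrite (pathalg_mulw (fsubset_refl (msupp h)) (fsubsetUl (msupp f) (msupp g))).
rewrite (pathalg_mulw (fsubset_refl (msupp h)) (fsubsetUr (msupp f) (msupp g))).
rewrite -big_split; apply: eq_bigr => p _; rewrite -big_split.
by apply: eq_bigr => q _ /=; rewrite mcoeffD mulrDr scalerDl.
Qed.

Lemma pathalg_mul0l f : mul 0 f = 0.
Proof. by apply: (addIr (mul 0 f)); rewrite -pathalg_mulDl !add0r. Qed.

Lemma pathalg_mul0r f : mul f 0 = 0.
Proof. by apply: (addIr (mul f 0)); rewrite -pathalg_mulDr !add0r. Qed.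

Lemma pathalg_mulZl c f g : mul (c *: f) g = c *: mul f g.
Proof.
rewrite (pathalg_mulw (msuppZ_le c f) (fsubset_refl _)).
rewrite pathalg_mul.unlock scaler_sumr.
apply: eq_bigr => p _; rewrite scaler_sumr; apply: eq_bigr => q _.
by rewrite mcoeffZ -mulrA scalerA.
Qed.

Lemma pathalg_mulZr c f g : mul f (c *: g) = c *: mul f g.
Proof.
rewrite (pathalg_mulw (fsubset_refl _) (msuppZ_le c g)).
rewrite pathalg_mul.unlock scaler_sumr.
apply: eq_bigr => p _; rewrite scaler_sumr; apply: eq_bigr => q _.
by rewrite mcoeffZ mulrCA scalerA.
Qed.

Lemma pathalg_mulUU p q : mul (pbasis p) (pbasis q) = pbasis_mul p q.
Proof.
rewrite (pathalg_mulw (msupp_pbasis p) (msupp_pbasis q)) !big_seq_fset1.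
by rewrite !mcoeff_pbasis !eqxx mulr1 scale1r.
Qed.

Lemma pathalg_ind (P : pathalg -> Prop) :
  P 0 -> (forall f g, P f -> P g -> P (f + g)) ->
  (forall c p, P (c *: pbasis p)) -> forall f, P f.
Proof.
move=> P0 PD PU f; rewrite [f]monalgE; elim/big_ind: _ => // p _.
suff <- : f@_p *: pbasis p = << f@_p *g p >> by exact: PU.
by apply/malgP => q; rewrite [LHS]mcoeffZ [RHS]mcoeffU mcoeff_pbasis mulr_natr.
Qed.

Lemma pathalg_mulA : associative mul.
Proof.
have midZ c f g h : mul f (mul g h) = mul (mul f g) h ->
    mul f (mul (c *: g) h) = mul (mul f (c *: g)) h.
  move=> fgh; rewrite (pathalg_mulZl c g h) (pathalg_mulZr c f (mul g h)) fgh.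
  by rewrite (pathalg_mulZr c f g) (pathalg_mulZl c (mul f g) h).
move=> f g h; elim/pathalg_ind: f => [|f f' IH IH'|c p].
- by rewrite !pathalg_mul0l.
- by rewrite !pathalg_mulDl IH IH'.
rewrite !pathalg_mulZl; congr (c *: _).
elim/pathalg_ind: g => [|f g IH IH'|d q].
- by rewrite pathalg_mul0l !pathalg_mul0r pathalg_mul0l.
- by rewrite !(pathalg_mulDl, pathalg_mulDr) IH IH'.
apply: midZ.
elim/pathalg_ind: h => [|f g IH IH'|e r].
- by rewrite !pathalg_mul0r.
- by rewrite !pathalg_mulDr IH IH'.
rewrite !pathalg_mulZr; congr (e *: _); rewrite !pathalg_mulUU.
have := pcompA p q r.
case: (pcomp q r) => [s|] /=; case: (pcomp p q) => [t|] /= pqr;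
  by rewrite ?pathalg_mul0l ?pathalg_mul0r ?pathalg_mulUU ?pqr // -?pqr.
Qed.

Lemma pathalg_mul1l : left_id pathalg_one mul.
Proof.
move=> f; elim/pathalg_ind: f => [|f g IH IH'|c p].
- by rewrite pathalg_mul0r.
- by rewrite pathalg_mulDr IH IH'.
rewrite pathalg_mulZr; congr (c *: _).
rewrite (big_morph (mul^~ _)
  (fun _ _ => pathalg_mulDl _ _ _) (pathalg_mul0l _)).
rewrite (bigD1 (psrc p)) //= big1 => [|v /negbTE vp];
  by rewrite pathalg_mulUU pcomp_triv ?eqxx ?vp // addr0.
Qed.

Lemma pathalg_mul1r : right_id pathalg_one mul.
Proof.
move=> f; elim/pathalg_ind: f => [|f g IH IH'|c p].
- by rewrite pathalg_mul0l.
- by rewrite pathalg_mulDl IH IH'.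
rewrite pathalg_mulZl; congr (c *: _).
rewrite (big_morph (mul _) (fun _ _ => pathalg_mulDr _ _ _) (pathalg_mul0r _)).
rewrite (bigD1 (ptgt p)) //= big1 => [|v /negbTE vp];
  by rewrite pathalg_mulUU pcompp_triv ?eqxx ?vp // addr0.
Qed.

HB.instance Definition _ := GRing.Zmodule_isPzRing.Build pathalg
  pathalg_mulA pathalg_mul1l pathalg_mul1r pathalg_mulDl pathalg_mulDr.

End PathAlgebra.

Section Ideals.
Variable R : pzRingType.

Definition is_ideal (I : set R) : Prop :=
  [/\ I 0, forall x y, I x -> I y -> I (x - y),
      forall a x, I x -> I (a * x) & forall a x, I x -> I (x * a)].

Record ideal := Ideal { ideal_set :> set R; idealP : is_ideal ideal_set }.

Definition ideal_gen (S : set R) : set R := smallest is_ideal S.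

Definition ideal_mul (I J : set R) : set R :=
  ideal_gen [set x * y | x in I & y in J].

Definition ideal_exp (I : set R) (n : nat) : set R :=
  iter n (ideal_mul I) setT.

Variable I : ideal.

Definition ideal_pred : {pred R} := fun x => `[< ideal_set I x >].

Lemma ideal_pred_zmod : zmod_closed ideal_pred.
Proof.
case: (idealP I) => I0 IB _ _; split; first exact/asboolP.
by move=> x y /asboolP Ix /asboolP Iy; apply/asboolP/IB.
Qed.

HB.instance Definition _ :=
  GRing.isZmodClosed.Build R ideal_pred ideal_pred_zmod.

Definition quot_ring : Type := Quotient.quot ideal_pred.
HB.instance Definition _ := GRing.Zmodule.on quot_ring.

Definition quot_pi (x : R) : quot_ring := (\pi_(Quotient.quot ideal_pred) x)%qT.
Definition quot_repr (x : quot_ring) : R := repr (x : Quotient.quot ideal_pred).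

Lemma quot_reprK : cancel quot_repr quot_pi.
Proof. exact: reprK. Qed.

Definition quot_one : quot_ring := quot_pi 1.
Definition quot_mul (x y : quot_ring) : quot_ring :=
  quot_pi (quot_repr x * quot_repr y).

Lemma quot_piE x y : quot_pi x = quot_pi y <-> ideal_set I (x - y).
Proof.
split=> [/eqP|Ixy]; first by rewrite -Quotient.idealrBE => /asboolP.
by apply/eqP; rewrite -Quotient.idealrBE; apply/asboolP.
Qed.

Lemma quot_piD x y : quot_pi (x + y) = quot_pi x + quot_pi y.
Proof. exact: Quotient.pi_add. Qed.

Lemma quot_piM x y : quot_pi (x * y) = quot_mul (quot_pi x) (quot_pi y).
Proof.
case: (idealP I) => I0 IB IMl IMr; apply/quot_piE.
have Irepr z : ideal_set I (z - quot_repr (quot_pi z)).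
  by apply/quot_piE; rewrite quot_reprK.
rewrite -[x * y](subrK (quot_repr (quot_pi x) * y)) -mulrBl -addrA -mulrBr.
rewrite -[_ * (_ - _)]opprK -mulrN opprB.
apply: (IB); first exact/IMr/Irepr.
by apply: IMl; rewrite -opprB -sub0r; apply: (IB) (Irepr y).
Qed.

Lemma quot_mulA : associative quot_mul.
Proof.
move=> x y z; rewrite -[x]quot_reprK -[y]quot_reprK -[z]quot_reprK.
by rewrite -!quot_piM mulrA.
Qed.

Lemma quot_mul1l : left_id quot_one quot_mul.
Proof. by move=> x; rewrite -[x]quot_reprK -quot_piM mul1r. Qed.

Lemma quot_mul1r : right_id quot_one quot_mul.
Proof. by move=> x; rewrite -[x]quot_reprK -quot_piM mulr1. Qed.

Lemma quot_mulDl : left_distributive quot_mul +%R.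
Proof.
move=> x y z; rewrite -[x]quot_reprK -[y]quot_reprK -[z]quot_reprK.
by rewrite -quot_piD -!quot_piM -quot_piD mulrDl.
Qed.

Lemma quot_mulDr : right_distributive quot_mul +%R.
Proof.
move=> x y z; rewrite -[x]quot_reprK -[y]quot_reprK -[z]quot_reprK.
by rewrite -quot_piD -!quot_piM -quot_piD mulrDr.
Qed.

HB.instance Definition _ := GRing.Zmodule_isPzRing.Build quot_ring
  quot_mulA quot_mul1l quot_mul1r quot_mulDl quot_mulDr.

End Ideals.

Definition arrow_ideal (K : fieldType) (Q : quiver) : set (pathalg K Q) :=
  ideal_gen (range (fun a => pbasis K (parrow a))).

Definition admissible (K : fieldType) (Q : quiver) (I : set (pathalg K Q)) :=
  exists n : nat, (2 <= n)%N /\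
    ideal_exp (@arrow_ideal K Q) n `<=` I /\
    I `<=` ideal_exp (@arrow_ideal K Q) 2.

Section Modules.
Variable R : pzRingType.

Definition finitely_generated (M : lmodType R) : Prop :=
  exists s : seq M, forall m : M,
    exists c : nat -> R, m = \sum_(i < size s) c i *: s`_i.

Definition projective (P : lmodType R) : Prop :=
  forall (M N : lmodType R) (g : {linear M -> N}) (f : {linear P -> N}),
    (forall y, exists x, g x = y) ->
    exists h : {linear P -> M}, forall x, g (h x) = f x.

(* 0 -> P_n -> ... -> P_0 -> M -> 0 *)
Record proj_resolution (M : lmodType R) (n : nat) := ProjResolution {
  res_mod : nat -> lmodType R;
  res_diff : forall i, {linear res_mod i.+1 -> res_mod i};
  res_aug : {linear res_mod 0 -> M};
  res_projective : forall i, projective (res_mod i);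
  res_bounded : forall i, (n < i)%N -> forall x : res_mod i, x = 0;
  res_aug_surj : forall m, exists x, res_aug x = m;
  res_exact0 : forall x, res_aug x = 0 <-> exists y, res_diff 0 y = x;
  res_exactS : forall i x, res_diff i x = 0 <-> exists y, res_diff i.+1 y = x
}.

Definition projdim_le (M : lmodType R) (n : nat) : Prop :=
  inhabited (proj_resolution M n).

(* [projdim M n]: the projective dimension of M is the natural number n, so
   in particular it is finite. *)
Definition projdim (M : lmodType R) (n : nat) : Prop :=
  projdim_le M n /\ forall m, projdim_le M m -> (n <= m)%N.

End Modules.

(* A right A-module is a left module over the converse ring. *)
Notation rmodType A := (lmodType A^c).

Definition findim_set (A : pzRingType) : set nat :=
  [set n | exists M : rmodType A, finitely_generated M /\ projdim M n].

Definition findim (A : pzRingType) (d : nat) : Prop :=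
  supremums (findim_set A) d.

Definition finite_findim (A : pzRingType) : Prop := exists d, findim A d.

(* Main.v *)
From HB Require Import structures.
From mathcomp Require Import all_boot all_algebra.
From mathcomp Require Import finmap monalg boolp classical_sets.
Require Import Defs.

(* Add to Q one arrow x_ij : i -> j for every pair of vertices, so that the new
   quiver Q' is path connected, and let I' be generated by I and by the paths in
   which a new arrow is followed by another arrow.  Put A = KQ/I, B = KQ'/I' and
   x_j = sum_i x_ij.  Then B = A + sum_j A x_j is free as a left A-module on 1 and
   the x_j, and A is a retract of B.  Hence M |-> M (x)_A B is exact and preserves
   projectives and finite generation, so pd_B (M (x)_A B) <= pd_A M.

   Conversely, let P be a finite A-projective resolution of M with differential
   d.  If pd_B (M (x)_A B) <= m, comparing P (x)_A B with a resolution of length m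
   gives a map h in degree m with d h d = d; the retraction brings h back to A.
   Then d h is an idempotent of P_m whose image is the image of d, so its kernel
   is a projective module at which P can be truncated, and pd_A M <= m.  Thus the
   finitistic dimension of A is at most that of B. *)

Set Implicit Arguments.
Unset Strict Implicit.
Unset Printing Implicit Defensive.

Import GRing.Theory.

Local Open Scope ring_scope.

(** * Resolutions *)

Lemma linear_ex (R : pzRingType) (U V : lmodType R) (f : U -> V) :
  linear f -> exists h : {linear U -> V}, h =1 f.
Proof.
move=> lf; pose hlf := GRing.isLinear.Build _ _ _ _ f lf.
by pose h : {linear U -> V} := HB.pack f hlf; exists h.
Qed.

(** * Kernels and projective modules *)

Section Kernel.
Variables (R : pzRingType) (U V : lmodType R) (u : {linear U -> V}).

Definition ker_pred : {pred U} := fun x => u x == 0.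

Lemma ker_pred_submod : submod_closed ker_pred.
Proof.
split=> [|a x y]; rewrite -!topredE /= /ker_pred ?linear0 //.
by rewrite linearP => /eqP-> /eqP->; rewrite scaler0 addr0.
Qed.

HB.instance Definition _ :=
  GRing.isSubmodClosed.Build R U ker_pred ker_pred_submod.

Record kernel := Kernel { kernel_val : U; _ : kernel_val \in ker_pred }.

HB.instance Definition _ := [isSub for kernel_val].
HB.instance Definition _ := [Choice of kernel by <:].
HB.instance Definition _ := [SubChoice_isSubLmodule of kernel by <:].

Lemma ker_predP x : reflect (u x = 0) (x \in ker_pred).
Proof. exact: eqP. Qed.

Lemma kernel_factor (W : lmodType R) (f : {linear W -> U}) :
  (forall x, f x \in ker_pred) ->
  exists g : {linear W -> kernel}, forall x, val (g x) = f x.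
Proof.
move=> fP; have [|g gE] := @linear_ex R W kernel (fun x => Kernel (fP x)).
  by move=> a x y; apply/val_inj; rewrite [RHS]linearP; apply: linearP.
by exists g => x; rewrite gE.
Qed.

End Kernel.

(** The pullback of [f] and [g], built as the kernel of [u] in [P * M], surjects onto [P]; the
    second component of a section of this projection is the lift. *)
Lemma projective_lift (R : pzRingType) (P M N : lmodType R)
    (g : {linear M -> N}) (f : {linear P -> N}) :
  projective P -> (forall x, exists y, g y = f x) ->
  exists h : {linear P -> M}, forall x, g (h x) = f x.
Proof.
move=> projP fg; pose u : {linear (P * M)%type -> N} := (f \o fst) \- (g \o snd).
pose p : {linear kernel u -> P} := fst \o val.
have [|s sP] := projP _ _ p idfun.
  move=> x; have [y yP] := fg x.
  have uxy : (x, y) \in ker_pred u by apply/ker_predP; rewrite /u /= yP subrr.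
  by exists (Kernel uxy).
exists (snd \o (val \o s)) => x /=.
have /ker_predP/eqP := valP (s x); rewrite /u /= subr_eq0 => /eqP <-.
by have /= -> := sP x.
Qed.

(** For an idempotent [u] the map [1 - u] retracts [P] onto [kernel u], which is thus a direct
    summand. *)
Lemma projective_kernel (R : pzRingType) (P : lmodType R) (u : {linear P -> P}) :
  projective P -> (forall x, u (u x) = u x) -> projective (kernel u).
Proof.
move=> projP uu M N g f gsurj.
have [|r rE] := @kernel_factor _ _ _ u _ (idfun \- u).
  by move=> x; apply/ker_predP; rewrite /= linearB uu subrr.
have [h hP] := projP _ _ g (f \o r) gsurj.
exists (h \o val) => x /=; rewrite hP /=; congr (f _).
by apply/val_inj; rewrite rE /=; have /ker_predP -> := valP x; rewrite subr0.
Qed.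

(** * Comparison of resolutions *)

Section Resolution.
Variables (R : pzRingType) (M : lmodType R) (n : nat) (P : proj_resolution M n).

(** With [M] in degree 0 and [P_i] in degree [i.+1], the fields [res_exact0] and [res_exactS] become
    the single statement [aug_exact]. *)
Definition aug_mod (i : nat) : lmodType R := if i is j.+1 then res_mod P j else M.

Definition aug_diff (i : nat) : {linear aug_mod i.+1 -> aug_mod i} :=
  if i is j.+1 return {linear aug_mod i.+1 -> aug_mod i} then res_diff P j
  else res_aug P.

Lemma aug_exact i x : aug_diff i x = 0 <-> exists y, aug_diff i.+1 y = x.
Proof. by case: i x => [|i] x; [exact: res_exact0|exact: res_exactS]. Qed.

Lemma aug_diffK i x : aug_diff i (aug_diff i.+1 x) = 0.
Proof. by apply/aug_exact; exists x. Qed.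

Lemma aug_projective i : projective (aug_mod i.+1).
Proof. exact: res_projective. Qed.

End Resolution.

(* [f], [g] compare the two resolutions and [h] is a homotopy between [g f] and
   the identity; all three are extended degree by degree, the homotopy
   identity [g f - 1 = d h + h d] being kept only up to composition with [d]. *)
Lemma comparison (R : pzRingType) (M : lmodType R) (n m : nat)
    (P : proj_resolution M n) (Q : proj_resolution M m) (i : nat) :
  exists (f : {linear aug_mod P i -> aug_mod Q i})
         (g : {linear aug_mod Q i -> aug_mod P i})
         (h : {linear aug_mod P i -> aug_mod P i.+1}),
    [/\ forall x, exists y, aug_diff Q i y = f (aug_diff P i x),
        forall x, exists y, aug_diff P i y = g (aug_diff Q i x) &
        forall x, aug_diff P i (h (aug_diff P i x)) =
                  g (f (aug_diff P i x)) - aug_diff P i x].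
Proof.
elim: i => [|i [f [g [h [fP gP hP]]]]].
  exists idfun, idfun, \0 => /=; split=> x.
  - exact: res_aug_surj.
  - exact: res_aug_surj.
  - by rewrite linear0 subrr.
have [f' f'P] := @projective_lift _ _ _ _ (aug_diff Q i) (f \o aug_diff P i)
  (aug_projective (i := i)) fP.
have [g' g'P] := @projective_lift _ _ _ _ (aug_diff P i) (g \o aug_diff Q i)
  (aug_projective (i := i)) gP.
(* By the induction hypothesis [d] kills [g' f' - 1 - h d], so by exactness this map lifts through
   the next differential. *)
have [|h' h'P] := @projective_lift _ _ _ _ (aug_diff P i.+1)
  (((g' \o f') \- idfun) \- (h \o aug_diff P i)) (aug_projective (i := i)).
  move=> x; apply/aug_exact => /=.
  by rewrite !linearB /= hP g'P /= f'P subrr.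
exists f', g', h'; split=> x.
- by apply/aug_exact; rewrite f'P /= aug_diffK linear0.
- by apply/aug_exact; rewrite g'P /= aug_diffK linear0.
- by rewrite h'P /= aug_diffK linear0 subr0.
Qed.

(** The map [f d] takes values in boundaries coming from [Q_(i+1) = 0], so it vanishes and the
    homotopy identity reduces to [d h d = - d]. *)
Lemma homotopy_splitting (R : pzRingType) (M : lmodType R) (n m i : nat)
    (P : proj_resolution M n) : projdim_le M m -> (m <= i)%N ->
  exists h : {linear res_mod P i -> res_mod P i.+1},
    forall x, res_diff P i (h (res_diff P i x)) = res_diff P i x.
Proof.
(* Augmented degrees are shifted by one: [comparison] at [i.+1] concerns [P_i]. *)
move=> [Q] le_mi; have [f [g [h [fP _ hP]]]] := comparison P Q i.+1.
exists (\- h) => x /=; rewrite linearN; have /= -> := hP x.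
have /= [y yP] := fP x.
by rewrite -yP (res_bounded _ y) ?ltnS // !linear0 sub0r opprK.
Qed.

(** * Truncation of a resolution at a split degree *)

Section Truncation.
Variables (R : pzRingType) (M : lmodType R) (n d : nat).
Variable P : proj_resolution M n.
Variable h : forall i, {linear res_mod P i -> res_mod P i.+1}.
Hypothesis hP : forall i, i = d ->
  forall x, res_diff P i (h i (res_diff P i x)) = res_diff P i x.

(** Idempotents whose kernels form the truncated complex: all of [P_i] below [d], a complement of
    the boundaries in degree [d], zero above. Taking a family [h] constrained by [i = d] avoids
    casts between the types [res_mod P i]. *)
Definition trunc_map i : {linear res_mod P i -> res_mod P i} :=
  if (i < d)%N then \0 : {linear _ -> _}
  else if i == d then res_diff P i \o h i : {linear _ -> _} else idfun.

Lemma trunc_map_lt i x : (i < d)%N -> trunc_map i x = 0.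
Proof. by rewrite /trunc_map => ->. Qed.

Lemma trunc_map_eq i x : i = d -> trunc_map i x = res_diff P i (h i x).
Proof. move=> ei; have [ltF eqT] : (i < d)%N = false /\ (i == d) = true.
  by rewrite ei ltnn eqxx.
by rewrite /trunc_map ltF eqT. Qed.

Lemma trunc_map_gt i x : (d < i)%N -> trunc_map i x = x.
Proof. by rewrite /trunc_map => lt_di; rewrite ltnNge ltnW // gtn_eqF. Qed.

Lemma trunc_diff_eq i x : i = d -> trunc_map i (res_diff P i x) = res_diff P i x.
Proof. by move=> ei; rewrite trunc_map_eq // hP. Qed.

Lemma trunc_map_idem i x : trunc_map i (trunc_map i x) = trunc_map i x.
Proof.
case: (ltngtP i d) => [lt|gt|ei].
- by rewrite !trunc_map_lt.
- by rewrite !trunc_map_gt.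
- by rewrite (trunc_map_eq x ei) trunc_diff_eq.
Qed.

Lemma trunc_kerB i x : x - trunc_map i x \in ker_pred (trunc_map i).
Proof. by apply/ker_predP; rewrite linearB trunc_map_idem subrr. Qed.

(** Below [d] the target kernel is everything; from [d] on the source kernel is zero. *)
Lemma trunc_ker_diff i x : x \in ker_pred (trunc_map i.+1) ->
  res_diff P i x \in ker_pred (trunc_map i).
Proof.
move=> /ker_predP x0; apply/ker_predP.
case: (ltnP i d) => [lt|le]; first by rewrite trunc_map_lt.
by move: x0; rewrite trunc_map_gt // => ->; rewrite !linear0.
Qed.

Lemma res_diffK i x : res_diff P i (res_diff P i.+1 x) = 0.
Proof. exact: (aug_diffK (P := P) (i := i.+1)). Qed.

Lemma res_augK x : res_aug P (res_diff P 0 x) = 0.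
Proof. exact: (aug_diffK (P := P) (i := 0)). Qed.

Lemma aug_trunc x : res_aug P (trunc_map 0 x) = 0.
Proof.
case: (posnP d) => [d0|lt0d]; last by rewrite trunc_map_lt // linear0.
by rewrite trunc_map_eq // res_augK.
Qed.

(** The idempotent has boundaries as values in degree [d] and is zero below, so correcting by it
    does not change differentials. *)
Lemma diff_trunc i x : (i < d)%N -> res_diff P i (trunc_map i.+1 x) = 0.
Proof.
rewrite leq_eqVlt => /orP[/eqP ei|lt]; last by rewrite trunc_map_lt // linear0.
by rewrite trunc_map_eq // res_diffK.
Qed.

(* A boundary in the kernel of the idempotent vanishes in degrees [>= d], and
   below [d] the preimage can be corrected by the idempotent. *)
Lemma trunc_preim i x : x \in ker_pred (trunc_map i) ->
  (exists y, res_diff P i y = x) ->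
  exists2 y, y \in ker_pred (trunc_map i.+1) & res_diff P i y = x.
Proof.
move=> /ker_predP x0 [y yx].
case: (ltnP i d) => [lt|le].
  exists (y - trunc_map i.+1 y); first exact: trunc_kerB.
  by rewrite linearB diff_trunc // subr0.
suff -> : x = 0.
  by exists 0; rewrite ?linear0 //; apply/ker_predP; rewrite linear0.
case: (ltngtP i d) le => // [gt _|ei _]; first by rewrite -x0 trunc_map_gt.
by rewrite -x0 -yx trunc_diff_eq.
Qed.

Lemma trunc_diff_ex i :
  exists f : {linear kernel (trunc_map i.+1) -> kernel (trunc_map i)},
    forall x, val (f x) = res_diff P i (val x).
Proof.
apply: (@kernel_factor _ _ _ _ _ (res_diff P i \o val)) => x /=.
exact/trunc_ker_diff/valP.
Qed.

Definition trunc_diff i := projT1 (cid (trunc_diff_ex i)).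

Lemma trunc_diffE i x : val (trunc_diff i x) = res_diff P i (val x).
Proof. by rewrite /trunc_diff; case: cid. Qed.

Lemma trunc_resolution : projdim_le M d.
Proof.
constructor; apply: (@ProjResolution _ _ _ (fun i => kernel (trunc_map i))
  trunc_diff (res_aug P \o val)).
- move=> i; apply: projective_kernel (trunc_map_idem (i := i)).
  exact: res_projective.
- move=> i lt x; apply/val_inj; rewrite linear0.
  by have /ker_predP := valP x; rewrite trunc_map_gt.
- move=> m; have [x <-] := res_aug_surj P m.
  exists (Kernel (trunc_kerB x)) => /=.
  by rewrite linearB aug_trunc subr0.
- move=> x; split=> [/= /res_exact0/trunc_preim [|y ky yx]|[y <-]] /=.
  + exact: valP.
  + by exists (Kernel ky); apply/val_inj; rewrite trunc_diffE.
  + by rewrite trunc_diffE res_augK.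
- move=> i x; split=> [/(congr1 val)|[y <-]].
    rewrite trunc_diffE linear0 => /res_exactS/trunc_preim [|y ky yx].
      exact: valP.
    by exists (Kernel ky); apply/val_inj; rewrite trunc_diffE.
  by apply/val_inj; rewrite !trunc_diffE res_diffK linear0.
Qed.

End Truncation.

Lemma projdim_le_splitting (R : pzRingType) (M : lmodType R) (n d : nat)
    (P : proj_resolution M n) (h : {linear res_mod P d -> res_mod P d.+1}) :
  (forall x, res_diff P d (h (res_diff P d x)) = res_diff P d x) ->
  projdim_le M d.
Proof.
move=> hP.
(* The truncation takes a map in every degree; outside degree [d] the zero map is used. *)
have ex i : exists h' : {linear res_mod P i -> res_mod P i.+1},
    i = d -> forall x, res_diff P i (h' (res_diff P i x)) = res_diff P i x.
  case: (i =P d) => [->|ne_id]; first by exists h => _; apply: hP.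
  by exists \0.
exact: (trunc_resolution (h := fun i => projT1 (cid (ex i)))
  (fun i => projT2 (cid (ex i)))).
Qed.

(** * Base change along a free extension *)

(** A synonym of [N] tagged by [phi], so that the [R]-module structure through [phi] can be attached
    to it. *)
Definition restrict_scalars (R S : pzRingType) (phi : {rmorphism R -> S})
  (N : lmodType S) : Type := N.

Section Restriction.
Variables (R S : pzRingType) (phi : {rmorphism R -> S}) (N : lmodType S).
Local Notation restrict := (restrict_scalars phi N).
HB.instance Definition _ := GRing.Zmodule.on restrict.

Definition restrict_scale (a : R) (x : restrict) : restrict := phi a *: (x : N).

Lemma restrict_scaleA a b x :
  restrict_scale a (restrict_scale b x) = restrict_scale (a * b) x.
Proof. by rewrite /restrict_scale scalerA rmorphM. Qed.

Lemma restrict_scale1 : left_id 1 restrict_scale.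
Proof. by move=> x; rewrite /restrict_scale rmorph1 scale1r. Qed.

Lemma restrict_scaleDr : right_distributive restrict_scale +%R.
Proof. by move=> a x y; apply: scalerDr. Qed.

Lemma restrict_scaleDl x : {morph restrict_scale^~ x : a b / a + b}.
Proof. by move=> a b; rewrite /restrict_scale rmorphD scalerDl. Qed.

HB.instance Definition _ := GRing.Zmodule_isLmodule.Build R restrict
  restrict_scaleA restrict_scale1 restrict_scaleDr restrict_scaleDl.

Lemma restrictZ (a : R) (x : restrict) : a *: x = phi a *: (x : N).
Proof. by []. Qed.

End Restriction.

(* [S] is free as a right [R]-module, and the projection onto the basis element
   [1] is linear on both sides. *)
Record free_extension (R S : pzRingType) := FreeExtension {
  ext_map : {rmorphism R -> S};
  ext_idx : finType;
  ext_basis : ext_idx -> S;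
  ext_coord : ext_idx -> S -> R;
  ext_idx1 : ext_idx;
  ext_coordD : forall k, {morph ext_coord k : s t / s + t};
  ext_coordM : forall k s a, ext_coord k (s * ext_map a) = ext_coord k s * a;
  ext_coord_basis : forall k l, ext_coord k (ext_basis l) = (k == l)%:R;
  ext_decomp : forall s, s = \sum_k ext_basis k * ext_map (ext_coord k s);
  ext_basis1 : ext_basis ext_idx1 = 1;
  ext_coord1 : forall a k,
    ext_coord ext_idx1 (ext_map a * ext_basis k) = (k == ext_idx1)%:R * a
}.

Arguments ext_decomp {R S} E s : rename.

Section BaseChange.
Variables (R S : pzRingType) (E : free_extension R S).
Local Notation phi := (ext_map E).
Local Notation T := (ext_idx E).
Local Notation b := (@ext_basis _ _ E).
Local Notation x := (@ext_coord _ _ E).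
Local Notation t1 := (ext_idx1 E).

Lemma ext_coord_sum k I (r : seq I) (F : I -> S) :
  x k (\sum_(i <- r) F i) = \sum_(i <- r) x k (F i).
Proof.
have x0 : x k 0 = 0 by apply: (addIr (x k 0)); rewrite -ext_coordD !add0r.
exact: (big_morph _ (ext_coordD k) x0).
Qed.

(** Left multiplication by [s] is right [R]-linear, so it acts on coordinates by the matrix with
    entries [x k (s * b l)]. *)
Lemma ext_coord_mul k s t : x k (s * t) = \sum_l x k (s * b l) * x l t.
Proof.
rewrite {1}[t](ext_decomp E) mulr_sumr ext_coord_sum.
by apply: eq_bigr => l _; rewrite mulrA ext_coordM.
Qed.

(* [S (x)_R M], an element being given by its coordinates along the basis. *)
Section Module.
Variable M : lmodType R.

Definition base_change : Type := {ffun T -> M}.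
HB.instance Definition _ := GRing.Zmodule.on base_change.

Definition base_change_scale (s : S) (m : base_change) : base_change :=
  [ffun k => \sum_j x k (s * b j) *: m j].

Lemma base_change_scaleA s t m :
  base_change_scale s (base_change_scale t m) = base_change_scale (s * t) m.
Proof.
apply/ffunP => k; rewrite !ffunE.
under eq_bigr => j _ do rewrite ffunE scaler_sumr.
rewrite exchange_big; apply: eq_bigr => l _.
rewrite -mulrA ext_coord_mul scaler_suml.
by apply: eq_bigr => j _; rewrite scalerA.
Qed.

Lemma base_change_scale1 : left_id 1 base_change_scale.
Proof.
move=> m; apply/ffunP => k; rewrite ffunE (bigD1 k) //= big1 => [|j jk].
  by rewrite mul1r ext_coord_basis eqxx scale1r addr0.
by rewrite mul1r ext_coord_basis eq_sym (negbTE jk) scale0r.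
Qed.

Lemma base_change_scaleDr : right_distributive base_change_scale +%R.
Proof.
move=> s m n; apply/ffunP => k; rewrite !ffunE -big_split.
by apply: eq_bigr => j _; rewrite ffunE scalerDr.
Qed.

Lemma base_change_scaleDl m : {morph base_change_scale^~ m : s t / s + t}.
Proof.
move=> s t; apply/ffunP => k; rewrite !ffunE -big_split.
by apply: eq_bigr => j _; rewrite mulrDl ext_coordD scalerDl.
Qed.

HB.instance Definition _ := GRing.Zmodule_isLmodule.Build S base_change
  base_change_scaleA base_change_scale1 base_change_scaleDr base_change_scaleDl.

Lemma base_changeZ (s : S) (m : base_change) k :
  (s *: m) k = \sum_j x k (s * b j) *: m j.
Proof. by rewrite ffunE. Qed.

(** The canonical map from [m] to [1 (x) m]. *)
Definition base_incl (m : M) : base_change := [ffun k => (k == t1)%:R *: m].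

Lemma base_incl1 m : base_incl m t1 = m.
Proof. by rewrite ffunE eqxx scale1r. Qed.

Lemma scale_base_incl (s : S) (m : M) k : (s *: base_incl m) k = x k s *: m.
Proof.
rewrite base_changeZ (bigD1 t1) //= big1 => [|j jt]; last first.
  by rewrite ffunE (negbTE jt) scale0r scaler0.
by rewrite base_incl1 addr0 ext_basis1 mulr1.
Qed.

Lemma base_incl_linear :
  linear (base_incl : M -> restrict_scalars phi base_change).
Proof.
move=> a m n; rewrite restrictZ; apply/ffunP => k.
rewrite [RHS]ffunE scale_base_incl !ffunE scalerDr; congr (_ + _).
by rewrite -[phi a]mul1r ext_coordM -(ext_basis1 E) ext_coord_basis scalerA.
Qed.

(** The coordinate at [t1] is therefore an [R]-linear retraction of [base_incl], used to bring maps
    between base changes back to [R]. *)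
Lemma base_change_pr a (m : base_change) : (phi a *: m) t1 = a *: m t1.
Proof.
rewrite base_changeZ (bigD1 t1) //= big1 => [|j jt].
  by rewrite ext_coord1 eqxx mul1r addr0.
by rewrite ext_coord1 (negbTE jt) mul0r scale0r.
Qed.

Lemma base_change_decomp (m : base_change) : m = \sum_j b j *: base_incl (m j).
Proof.
apply/ffunP => k; rewrite sum_ffunE (bigD1 k) //= big1 => [|j jk].
  by rewrite scale_base_incl ext_coord_basis eqxx scale1r addr0.
by rewrite scale_base_incl ext_coord_basis eq_sym (negbTE jk) scale0r.
Qed.

Lemma base_change_fg : finitely_generated M -> finitely_generated base_change.
Proof.
move=> [s sP]; exists (map base_incl s) => m.
have [c cP] := choice (fun k : T => sP (m k)).
(* Expand [m] along the basis, then each coordinate [m j] in the generators [s]. *)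
exists (fun i => \sum_j b j * phi (c j i)).
rewrite {1}[m]base_change_decomp size_map.
under [RHS]eq_bigr => i _ do rewrite scaler_suml.
rewrite exchange_big; apply: eq_bigr => j _.
have [f fE] := linear_ex base_incl_linear.
rewrite cP -fE linear_sum scaler_sumr; apply: eq_bigr => i _.
by rewrite linearZ_LR restrictZ scalerA (nth_map 0) // fE.
Qed.

(** Universal property of extension of scalars; [ext_decomp] makes the map given by the sum of the
    [b j *: g (m j)] linear over [S]. *)
Lemma base_change_extend (N : lmodType S)
    (g : {linear M -> restrict_scalars phi N}) :
  exists h : {linear base_change -> N}, forall m, h (base_incl m) = g m.
Proof.
have [|h hE] := @linear_ex _ base_change N (fun m => \sum_j b j *: (g (m j) : N)).
  move=> s m n; rewrite scaler_sumr.
  under eq_bigr => j _ do rewrite ffunE base_changeZ linearD scalerDr.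
  rewrite big_split; congr (_ + _).
  under eq_bigr => k _ do rewrite linear_sum scaler_sumr.
  rewrite exchange_big; apply: eq_bigr => j _.
  under eq_bigr => k _ do rewrite linearZ_LR restrictZ scalerA.
  by rewrite -scaler_suml -(ext_decomp E) scalerA.
exists h => m; rewrite hE (bigD1 t1) //= big1 => [|j jt].
  by rewrite base_incl1 ext_basis1 scale1r addr0.
by rewrite ffunE (negbTE jt) scale0r linear0 scaler0.
Qed.

Lemma base_change_ext (N : lmodType S) (f g : {linear base_change -> N}) :
  (forall m, f (base_incl m) = g (base_incl m)) -> f =1 g.
Proof.
move=> fg m; rewrite [m]base_change_decomp !linear_sum.
by apply: eq_bigr => j _; rewrite !linearZ /= fg.
Qed.

End Module.

(** Extension of scalars is left adjoint to restriction, which preserves surjections: the lifting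
    problem is solved over [R] on [base_incl] and extended back. *)
Lemma base_change_projective (P : lmodType R) :
  projective P -> projective (base_change P).
Proof.
move=> projP M N g f gsurj.
have [|g' g'E] :=
    @linear_ex R (restrict_scalars phi M) (restrict_scalars phi N) g.
  by move=> a u v; rewrite !restrictZ linearP.
have [|f' f'E] :=
    @linear_ex R P (restrict_scalars phi N) (fun m => f (base_incl m)).
  by move=> a u v; rewrite (base_incl_linear a u v) linearP.
have [|h' h'P] := projP _ _ g' f'.
  by move=> y; have [z zP] := gsurj y; exists z; rewrite g'E.
have [h hP] := base_change_extend h'.
exists h; apply: (base_change_ext (f := g \o h)) => m /=.
by rewrite hP -f'E -h'P g'E.
Qed.

Section Map.
Variables (M N : lmodType R) (f : {linear M -> N}).

Lemma base_change_map_ex : exists g : {linear base_change M -> base_change N},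
  forall m k, g m k = f (m k).
Proof.
have [|g gE] := @linear_ex S (base_change M) (base_change N)
    (fun m => [ffun k => f (m k)]).
  move=> s m n; apply/ffunP => k; rewrite ffunE [(_ + _ : base_change M) k]ffunE.
  rewrite linearD [RHS]ffunE !base_changeZ; congr (_ + _); last by rewrite ffunE.
  by rewrite linear_sum; apply: eq_bigr => j _; rewrite linearZ ffunE.
by exists g => m k; rewrite gE ffunE.
Qed.

Definition base_change_map := projT1 (cid base_change_map_ex).

Lemma base_change_mapE m k : base_change_map m k = f (m k).
Proof. by rewrite /base_change_map; case: cid. Qed.

Lemma base_change_map_incl m : base_change_map (base_incl m) = base_incl (f m).
Proof. by apply/ffunP => k; rewrite base_change_mapE !ffunE linearZ. Qed.

Lemma base_change_map_surj :
  (forall y, exists z, f z = y) -> forall n, exists m, base_change_map m = n.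
Proof.
move=> fsurj n; have [m mP] := choice (fun k : T => fsurj (n k)).
by exists [ffun k => m k]; apply/ffunP => k; rewrite base_change_mapE ffunE.
Qed.

End Map.

(** The maps act coordinate by coordinate, so preimages can be chosen in each coordinate. *)
Lemma base_change_map_exact (L M N : lmodType R) (f : {linear L -> M})
    (g : {linear M -> N}) :
  (forall m, g m = 0 <-> exists y, f y = m) ->
  forall m, base_change_map g m = 0 <-> exists y, base_change_map f y = m.
Proof.
move=> fg m; split=> [gm0|[y <-]].
  have ex k : exists y, f y = m k.
    by apply/fg; rewrite -base_change_mapE gm0 ffunE.
  have [y yP] := choice ex.
  by exists [ffun k => y k]; apply/ffunP => k; rewrite base_change_mapE ffunE.
apply/ffunP => k; rewrite !base_change_mapE ffunE; apply/fg.
by exists (y k).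
Qed.

Definition base_change_resolution (M : lmodType R) n (P : proj_resolution M n) :
  proj_resolution (base_change M) n.
Proof.
apply: (@ProjResolution _ _ _ (fun i => base_change (res_mod P i))
  (fun i => base_change_map (res_diff P i)) (base_change_map (res_aug P))).
- by move=> i; apply/base_change_projective/res_projective.
- by move=> i lt m; apply/ffunP => k; rewrite ffunE; apply: res_bounded lt _.
- exact/base_change_map_surj/res_aug_surj.
- exact/base_change_map_exact/res_exact0.
- by move=> i; apply/base_change_map_exact/res_exactS.
(* Transparent, so that its modules and differentials unfold in [base_change_projdim_le]. *)
Defined.

(** A splitting over [S] in degree [d], restricted along [base_incl] and read at [t1], is a
    splitting of [P] over [R] in the same degree. *)
Lemma base_change_projdim_le (M : lmodType R) n d :
  projdim_le M n -> projdim_le (base_change M) d -> projdim_le M d.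
Proof.
move=> [P] FMd.
have [h hP] := homotopy_splitting (base_change_resolution P) FMd (leqnn d).
have [|h' h'E] := @linear_ex R (res_mod P d) (res_mod P d.+1)
    (fun m => (h (base_incl m) : base_change _) t1).
  move=> a u v; rewrite (base_incl_linear a u v) linearP ffunE.
  by rewrite base_change_pr.
apply: (projdim_le_splitting (P := P) (h := h')) => m.
rewrite h'E -base_change_mapE -base_change_map_incl.
have /= -> := hP (base_incl m).
by rewrite base_change_map_incl base_incl1.
Qed.

Lemma projdim_le_exact (A : pzRingType) (M : lmodType A) n :
  projdim_le M n -> exists2 m, projdim M m & (m <= n)%N.
Proof.
move=> Mn; pose p k := `[< projdim_le M k >].
have ex : exists k, p k by exists n; apply/asboolP.
case: (ex_minnP ex) => m /asboolP Mm min; exists m; last exact/min/asboolP.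
by split=> // k Mk; apply/min/asboolP.
Qed.

Lemma base_change_findim d :
  (forall (N : lmodType S) n,
     finitely_generated N -> projdim N n -> (n <= d)%N) ->
  forall (M : lmodType R) n, finitely_generated M -> projdim M n -> (n <= d)%N.
Proof.
move=> bound M n fgM [[P] min].
have [m FMm _] := projdim_le_exact (inhabits (base_change_resolution P)).
have le_md := bound _ _ (base_change_fg fgM) FMm.
apply: leq_trans le_md; apply: min.
by case: FMm => FMm _; apply: base_change_projdim_le FMm; constructor; exact: P.
Qed.

End BaseChange.

(** * Path algebras *)

Section Ideals.
Variable R : pzRingType.
Implicit Types (I : set R) (x y : R).

Lemma ideal_gen_ideal (X : set R) : is_ideal (ideal_gen X).
Proof.
split=> [J [[]]//|x y Ix Iy J JP|a x Ix J JP|a x Ix J JP];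
  have [[J0 JB JMl JMr] _] := JP.
- by apply: JB; [apply: Ix|apply: Iy].
- by apply: JMl; apply: Ix.
- by apply: JMr; apply: Ix.
Qed.

Lemma mem_ideal_gen (X : set R) x : X x -> ideal_gen X x.
Proof. by move=> Xx J [_]; apply. Qed.

Lemma ideal_gen_sub (X J : set R) :
  is_ideal J -> (forall x, X x -> J x) -> forall x, ideal_gen X x -> J x.
Proof. by move=> Jid XJ x; apply; split. Qed.

Lemma ideal_exp_ideal (J : set R) n : is_ideal (ideal_exp J n).
Proof. by case: n => [|n]; [split|apply: ideal_gen_ideal]. Qed.

Lemma is_idealD I x y : is_ideal I -> I x -> I y -> I (x + y).
Proof.
move=> [I0 IB _ _] Ix Iy; rewrite -[y]opprK -[- y]sub0r.
exact: (IB) Ix (IB _ _ I0 Iy).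
Qed.

Lemma is_ideal_sum I (T : Type) (r : seq T) (P : pred T) (F : T -> R) :
  is_ideal I -> (forall i, P i -> I (F i)) -> I (\sum_(i <- r | P i) F i).
Proof.
move=> idI IF; apply: (big_ind I) => //; first by case: idI.
by move=> x y; apply: is_idealD.
Qed.

End Ideals.

Section PathAlgebraMaps.
Variables (K : fieldType) (Q : quiver).
Local Notation A := (pathalg K Q).
Implicit Types f g : A.

Lemma pathalgE f : f = \sum_(p <- msupp f) f@_p *: pbasis K p.
Proof.
rewrite {1}[f]monalgE; apply: eq_bigr => p _; apply/malgP => q.
by rewrite [LHS]mcoeffU [RHS]mcoeffZ mcoeff_pbasis mulr_natr.
Qed.

Lemma pathalgMZl (c : K) f g : (c *: f) * g = c *: (f * g).
Proof. exact: pathalg_mulZl. Qed.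

Lemma pathalgMZr (c : K) f g : f * (c *: g) = c *: (f * g).
Proof. exact: pathalg_mulZr. Qed.

Lemma pbasisM (p q : qpath Q) :
  pbasis K p * pbasis K q = oapp (@pbasis K Q) 0 (pcomp p q).
Proof. exact: pathalg_mulUU. Qed.

Lemma is_idealZ (I : set A) (c : K) f : is_ideal I -> I f -> I (c *: f).
Proof.
by move=> [_ _ IM _] If; rewrite -[f]mul1r -pathalgMZl; apply: IM.
Qed.

Variables (W : lmodType K) (u : qpath Q -> W).

Definition pathalg_ext f : W := \sum_(p <- msupp f) f@_p *: u p.

Lemma pathalg_extw (d : {fset qpath Q}) f :
  (msupp f `<=` d)%fset -> pathalg_ext f = \sum_(p <- d) f@_p *: u p.
Proof.
move=> le; apply: (big_fset_incl _ le) => p _ /mcoeff_outdom ->.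
by rewrite scale0r.
Qed.

Lemma pathalg_ext_linear : linear pathalg_ext.
Proof.
move=> c f g; pose d := (msupp (c *: f + g) `|` (msupp f `|` msupp g))%fset.
have le_f : (msupp f `<=` d)%fset.
  exact: fsubset_trans (fsubsetUl _ _) (fsubsetUr _ _).
have le_g : (msupp g `<=` d)%fset.
  exact: fsubset_trans (fsubsetUr _ _) (fsubsetUr _ _).
rewrite (pathalg_extw (fsubsetUl _ _ : (_ `<=` d)%fset)).
rewrite (pathalg_extw le_f) (pathalg_extw le_g) scaler_sumr -big_split.
by apply: eq_bigr => p _; rewrite mcoeffD mcoeffZ scalerDl scalerA.
Qed.

HB.instance Definition _ :=
  GRing.isLinear.Build K A W _ pathalg_ext pathalg_ext_linear.

Lemma pathalg_ext_basis p : pathalg_ext (pbasis K p) = u p.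
Proof.
rewrite (pathalg_extw (msupp_pbasis K p)) big_seq_fset1.
by rewrite mcoeff_pbasis eqxx scale1r.
Qed.

End PathAlgebraMaps.

Lemma pathalg_linear_eq (K : fieldType) (Q : quiver) (W : lmodType K)
    (u v : {linear pathalg K Q -> W}) :
  (forall p, u (pbasis K p) = v (pbasis K p)) -> u =1 v.
Proof.
move=> uv f; rewrite [f]pathalgE !linear_sum.
by apply: eq_bigr => p _; rewrite !linearZ_LR uv.
Qed.

(** * Powers of the arrow ideal and path length *)

Section Length.
Variables (K : fieldType) (Q : quiver).
Local Notation A := (pathalg K Q).
Local Notation J := (@arrow_ideal K Q).
Implicit Types f g : A.

(** The span of the paths of length at least [n]. By [ideal_expE] it is [J^n], which turns
    admissibility into a condition on coefficients. *)
Definition length_ge (n : nat) : set A :=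
  fun f => forall p, (size (parrows p) < n)%N -> f@_p = 0.

Lemma mcoeffM f g r : (f * g)@_r =
  \sum_(p <- msupp f) \sum_(q <- msupp g)
    (f@_p * g@_q) * (oapp (@pbasis K Q) 0 (pcomp p q))@_r.
Proof.
have -> : f * g = pathalg_mul f g by [].
rewrite pathalg_mul.unlock raddf_sum.
apply: eq_bigr => p _; rewrite raddf_sum.
by apply: eq_bigr => q _; apply: mcoeffZ.
Qed.

Lemma length_geM m n f g :
  length_ge m f -> length_ge n g -> length_ge (m + n) (f * g).
Proof.
move=> fm gn r lt; rewrite mcoeffM big1 // => p _; rewrite big1 // => q _.
have [/fm ->|le_mp] := ltnP (size (parrows p)) m; first by rewrite !mul0r.
have [/gn ->|le_nq] := ltnP (size (parrows q)) n; first by rewrite mulr0 mul0r.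
case: pcompP => [t _ _ _ tpq|_]; rewrite /= ?mcoeff0 ?mulr0 //.
rewrite mcoeff_pbasis; case: eqP => [tr|_]; last by rewrite mulr0.
by move: lt; rewrite -tr tpq size_cat ltnNge leq_add.
Qed.

Lemma length_ge_ideal n : is_ideal (length_ge n).
Proof.
split=> [p _|f g fn gn p lt|a f fn|a f fn].
- exact: mcoeff0.
- by rewrite mcoeffB fn // gn // subr0.
- by apply: (@length_geM 0).
- by rewrite -[n]addn0; apply: length_geM.
Qed.

(** Induction on [n]: a path of positive length is its first arrow times the rest. *)
Lemma pbasis_ideal_exp n p :
  (n <= size (parrows p))%N -> ideal_exp J n (pbasis K p).
Proof.
elim: n p => [|n IHn] p; first by [].
case: p => [[v [|a s]] //= wp] le_ns.
have /andP[/eqP av ws] := wp.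
pose q : qpath Q := @QPath Q (tgt a, s) ws.
have -> : pbasis K (@QPath Q (v, a :: s) wp) = pbasis K (parrow a) * pbasis K q.
  rewrite pbasisM; case: pcompP => [r _ r1 _ r2|[]] //=; congr pbasis.
  by apply: qpath_eq; rewrite ?r1 ?r2.
apply: mem_ideal_gen; exists (pbasis K (parrow a)).
  by apply: mem_ideal_gen; exists a.
by exists (pbasis K q) => //; apply: IHn.
Qed.

Lemma ideal_expE n f : ideal_exp J n f <-> length_ge n f.
Proof.
split=> [|fn].
  elim: n f => [|n IHn] f; first by move=> _ p.
  apply: ideal_gen_sub; first exact: length_ge_ideal.
  move=> _ [g Jg [h Jh <-]]; apply: (@length_geM 1); last exact: IHn.
  move: g Jg {h Jh}; apply: ideal_gen_sub; first exact: length_ge_ideal.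
  by move=> _ [a _ <-] p; rewrite mcoeff_pbasis; case: eqP => // <-.
rewrite [f]pathalgE; apply: is_ideal_sum => [|p _]; first exact: ideal_exp_ideal.
have [/fn ->|le] := ltnP (size (parrows p)) n.
  by rewrite scale0r; case: (ideal_exp_ideal J n).
by apply: is_idealZ; [apply: ideal_exp_ideal|apply: pbasis_ideal_exp].
Qed.

Lemma admissibleP (I : set A) : admissible I <-> exists n, (2 <= n)%N /\
  (forall f, length_ge n f -> I f) /\ (forall f, I f -> length_ge 2 f).
Proof.
split=> -[n [le2n [JI IJ]]]; exists n; split=> //; split=> f.
- by move=> /ideal_expE/JI.
- by move=> /IJ/ideal_expE.
- by move=> /ideal_expE/JI.
- by move=> /IJ/ideal_expE.
Qed.

End Length.

(** * The path connected extension of a quiver *)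

Section Pull.
Variables (K : fieldType) (Q Q' : quiver) (j : qpath Q -> qpath Q').
Hypothesis j_inj : injective j.

(** The linear projection that sends [j r] back to [r] and kills the paths outside the image of [j];
    by [mcoeff_pull] it reads off the coefficients along [j]. *)
Definition pull : pathalg K Q' -> pathalg K Q :=
  pathalg_ext (fun p =>
    if pselect (exists r, j r = p) is left ex then pbasis K (projT1 (cid ex))
    else 0).

HB.instance Definition _ := GRing.Linear.on pull.

Lemma pull_basis r : pull (pbasis K (j r)) = pbasis K r.
Proof.
rewrite /pull pathalg_ext_basis; case: pselect => [ex|[]]; last by exists r.
by case: cid => s e /=; rewrite (j_inj e).
Qed.

Lemma pull_basis0 p : (forall r, j r <> p) -> pull (pbasis K p) = 0.
Proof.
move=> np; rewrite /pull pathalg_ext_basis.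
by case: pselect => // ex; have [r /np] := ex.
Qed.

Variant pull_basis_spec p : pathalg K Q -> Prop :=
| PullBasis r of p = j r : pull_basis_spec p (pbasis K r)
| PullBasis0 of (forall r, j r <> p) : pull_basis_spec p 0.

Lemma pull_basisP p : pull_basis_spec p (pull (pbasis K p)).
Proof.
case: (pselect (exists r, j r = p)) => [[r <-]|np].
  by rewrite pull_basis; apply: PullBasis.
have {}np r : j r <> p by move=> rp; apply: np; exists r.
by rewrite pull_basis0 //; apply: PullBasis0.
Qed.

Lemma mcoeff_pull f r : (pull f)@_r = f@_(j r).
Proof.
rewrite [f in LHS]pathalgE [f in RHS]pathalgE linear_sum !raddf_sum.
apply: eq_bigr => p _; rewrite linearZ_LR.
rewrite [LHS]mcoeffZ [RHS]mcoeffZ; congr (_ * _).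
rewrite mcoeff_pbasis /=; case: pull_basisP => [s ->|np].
  by rewrite mcoeff_pbasis (inj_eq j_inj).
by rewrite mcoeff0; case: eqP => // /esym/np.
Qed.

End Pull.

(** * Old and new paths of the extended quiver *)

Section ExtendedQuiver.
Variables (K : fieldType) (Q : quiver).

Definition ext_quiver : quiver :=
  @Quiver (vertex Q) (arrow Q + vertex Q * vertex Q)%type
    (fun a => match a with inl a => src a | inr ij => ij.1 end)
    (fun a => match a with inl a => tgt a | inr ij => ij.2 end).

Local Notation Q' := ext_quiver.
Implicit Types (p q : qpath Q') (r : qpath Q).

Lemma ext_quiver_connected : path_connected Q'.
Proof.
by move=> v w; split;
  [exists (@parrow Q' (inr (v, w)))|exists (@parrow Q' (inr (w, v)))].
Qed.

Lemma walk_inl (v : vertex Q) (s : seq (arrow Q)) :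
  walk (Q := Q') v (map inl s) = walk v s.
Proof. by elim: s v => //= a s IHs v; rewrite IHs. Qed.

Lemma walk_end_inl (v : vertex Q) (s : seq (arrow Q)) :
  walk_end (Q := Q') v (map inl s) = walk_end v s.
Proof. by elim: s v => //= a s IHs v; rewrite -IHs. Qed.

Lemma old_subproof r : walk (Q := Q') (psrc r) (map inl (parrows r)).
Proof. by rewrite walk_inl; apply: (valP r). Qed.

(* [old r] is the path [r] in the extended quiver, and [new j r] is [r] followed
   by the new arrow from its end to [j]. *)
Definition old r : qpath Q' := QPath (qpath_val := (_, _)) (old_subproof r).

Lemma new_subproof (j : vertex Q) r :
  walk (Q := Q') (psrc r) (rcons (map inl (parrows r)) (inr (ptgt r, j))).
Proof. by rewrite -cats1 walk_cat old_subproof /= walk_end_inl eqxx. Qed.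

Definition new j r : qpath Q' := QPath (qpath_val := (_, _)) (new_subproof j r).

Lemma ptgt_old r : ptgt (old r) = ptgt r.
Proof. exact: walk_end_inl. Qed.

Lemma ptgt_new j r : ptgt (new j r) = j.
Proof.
have end_rcons v s (a : arrow Q') : walk_end v (rcons s a) = tgt a.
  by rewrite -cats1 walk_end_cat.
exact: end_rcons.
Qed.

Lemma inl_inj : injective (inl : arrow Q -> arrow Q').
Proof. by move=> a b []. Qed.

Lemma old_inj : injective old.
Proof.
move=> r s rs; apply: qpath_eq; first by have := congr1 (@psrc Q') rs.
exact/(inj_map inl_inj)/(congr1 (@parrows Q') rs).
Qed.

Lemma new_inj j : injective (new j).
Proof.
move=> r s rs; apply: qpath_eq; first by have := congr1 (@psrc Q') rs.
have /rcons_inj[] := congr1 (@parrows Q') rs.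
by move=> /(inj_map inl_inj).
Qed.

Definition isl (a : arrow Q') : bool := if a is inl _ then true else false.

Lemma all_isl_map (s : seq (arrow Q)) : all isl (map inl s).
Proof. by rewrite all_map; apply/allP. Qed.

Lemma all_isl_ex (s : seq (arrow Q')) :
  all isl s -> exists t : seq (arrow Q), s = map inl t.
Proof.
elim: s => [_|[a|//] s IHs /= /IHs[t ->]]; first by exists [::].
by exists (a :: t).
Qed.

Lemma oldP p : all isl (parrows p) -> exists r, p = old r.
Proof.
move=> /all_isl_ex[t pt]; have wt : @walk Q (psrc p) t.
  by rewrite -walk_inl -pt; apply: (valP p).
by exists (@QPath Q (psrc p, t) wt); apply: qpath_eq.
Qed.

Lemma newP p s ij : all isl s -> parrows p = rcons s (inr ij) ->
  exists r, p = new ij.2 r.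
Proof.
move=> /all_isl_ex[t ->] pt.
have := valP p; rewrite /= -/(psrc p) -/(parrows p) pt -cats1 walk_cat walk_inl.
case/and3P => wt /= /eqP ei _.
exists (@QPath Q (psrc p, t) wt); apply: qpath_eq => //.
rewrite pt /=; congr (rcons _ (inr _)).
by rewrite /ptgt /= -walk_end_inl -ei; case: (ij).
Qed.

Lemma pcomp_old r s : pcomp (old r) (old s) = omap old (pcomp r s).
Proof.
case: (pcompP r s) => [t rs t1 t2 t3|rs]; case: pcompP; rewrite ?ptgt_old //=.
move=> u _ u1 _ u3; congr Some; apply: qpath_eq; first by rewrite u1 [RHS]t1.
by rewrite u3 [RHS]/parrows /= -/(parrows _) t3 map_cat.
Qed.

Lemma pcomp_old_new j r s :
  pcomp (old r) (new j s) = omap (new j) (pcomp r s).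
Proof.
case: (pcompP r s) => [t rs t1 t2 t3|rs]; case: pcompP; rewrite ?ptgt_old //=.
move=> u _ u1 _ u3; congr Some; apply: qpath_eq; first by rewrite u1 [RHS]t1.
rewrite u3 [RHS]/parrows /= -/(parrows t) t3 map_cat t2.
by rewrite [parrows (new _ _)]/parrows /= rcons_cat.
Qed.

Local Notation A := (pathalg K Q).
Local Notation A' := (pathalg K Q').
Implicit Types f g : A'.

Definition old_part : A' -> A := pull old.
HB.instance Definition _ := GRing.Linear.on old_part.

Definition new_part j : A' -> A := pull (new j).
HB.instance Definition _ j := GRing.Linear.on (new_part j).

(** A composite has only old arrows exactly when both factors do. *)
Lemma old_partM_basis p q :
  old_part (pbasis K p * pbasis K q) =
  old_part (pbasis K p) * old_part (pbasis K q).
Proof.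
rewrite pbasisM /old_part.
case: (boolP (all isl (parrows p ++ parrows q))) => [|npq].
  rewrite all_cat => /andP[/oldP[r ->] /oldP[s ->]].
  rewrite !(pull_basis _ old_inj) pbasisM pcomp_old.
  by case: (pcomp r s) => [t|] /=; rewrite ?linear0 ?(pull_basis _ old_inj).
have -> : pull old (oapp (pbasis K (Q:=Q')) 0 (pcomp p q)) = 0.
  case: pcompP => [t _ _ _ t3|_] /=; last by rewrite linear0.
  by apply: pull_basis0 => r rt; move: npq; rewrite -t3 -rt all_isl_map.
case: (pull_basisP K old_inj _) => // [r pr|_]; last by rewrite mul0r.
case: (pull_basisP K old_inj _) => // [s qs|_]; last by rewrite mulr0.
by move: npq; rewrite pr qs all_cat !all_isl_map.
Qed.

(** If [p] followed by [q] is a [new j] path, then either [p] is old and [q] is a [new j] path, or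
    [q] is trivial, necessarily at [j]. The last term accounts for the second case. *)
Lemma new_partM_basis j p q :
  new_part j (pbasis K p * pbasis K q) =
  old_part (pbasis K p) * new_part j (pbasis K q)
    + (pbasis K q)@_(@ptriv Q' j) *: new_part j (pbasis K p).
Proof.
rewrite mcoeff_pbasis pbasisM /old_part /new_part.
have [q0|[s [a qs]]] : parrows q = [::] \/ exists s a, parrows q = rcons s a.
  by case/lastP: (parrows q) => [|s a]; [left|right; exists s, a].
  have {q0} -> : q = ptriv (psrc q) by apply: qpath_eq.
  rewrite pcompp_triv [pull (new j) (pbasis K (ptriv _))]pull_basis0; last first.
    by move=> r /(congr1 (size \o @parrows Q')); rewrite /= size_rcons.
  have -> : (ptriv (psrc q) == @ptriv Q' j) = (psrc q == j).
    by apply/eqP/eqP => [/(congr1 (@psrc Q'))|->].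
  rewrite mulr0 add0r; case: (eqVneq (psrc q) (ptgt p)) => [->|ne] /=.
    case: (pull_basisP K (@new_inj j) p) => // [r ->|_]; last by rewrite scaler0.
    by rewrite ptgt_new eqxx scale1r.
  rewrite linear0.
  case: (pull_basisP K (@new_inj j) p) => // [r pr|_]; last first.
    by rewrite scaler0.
  by move: ne; rewrite pr ptgt_new => /negbTE ->; rewrite scale0r.
have -> : (q == @ptriv Q' j) = false.
  by apply/eqP => q0; move: qs; rewrite q0; case: (s).
rewrite scale0r addr0.
(* For nontrivial [q], a composite [new j w] forces [p] to be old and [q] to be a [new j] path; each
   alternative excludes this. *)
have ncomp : pull (new j) (pbasis K q) = 0 \/ ~~ all isl (parrows p) ->
    pull (new j) (oapp (@pbasis K Q') 0 (pcomp p q)) = 0.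
  case: pcompP => [t _ _ _ t3|_] npq /=; last by rewrite linear0.
  apply: pull_basis0 => w wt; move: t3; rewrite -wt qs -rcons_cat => /rcons_inj[].
  move=> pw aw; have := all_isl_map (parrows w); rewrite pw all_cat.
  case/andP => pl sl; case: npq => [|/negP[]] //.
  have [r ->] : exists r, q = new j r.
    by apply: (@newP _ s (ptgt w, j)); rewrite ?aw.
  rewrite pull_basis; last exact: new_inj.
  by move/malgP/(_ r)/eqP; rewrite mcoeff_pbasis mcoeff0 eqxx oner_eq0.
case: (boolP (all isl (parrows p))) => [/oldP[r pr]|np]; last first.
  rewrite ncomp; last by right.
  case: (pull_basisP K old_inj p) => // [r pr|_]; last by rewrite mul0r.
  by move: np; rewrite pr all_isl_map.
case: (pull_basisP K (@new_inj j) q) ncomp => // [s' qs' _|_ ->]; last first.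
- by left.
- by rewrite mulr0.
rewrite pr qs' (pull_basis _ old_inj) pcomp_old_new pbasisM.
by case: (pcomp r s') => [t|] /=; rewrite ?linear0 ?(pull_basis _ (@new_inj j)).
Qed.

End ExtendedQuiver.

Lemma scalerCA (K : fieldType) (V : lmodType K) (c d : K) (v : V) :
  c *: (d *: v) = d *: (c *: v).
Proof. by rewrite !scalerA mulrC. Qed.

(** * Coordinates on the extended path algebra and the extended ideal *)

Section ExtendedAlgebra.
Variables (K : fieldType) (Q : quiver).
Local Notation Q' := (ext_quiver Q).
Local Notation A := (pathalg K Q).
Local Notation A' := (pathalg K Q').
Implicit Types (f g : A') (a : A).

Lemma old_partM f g : old_part (f * g) = old_part f * old_part g.
Proof.
elim/pathalg_ind: f => [|f f' IH IH'|c p].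
- by rewrite mul0r linear0 mul0r.
- by rewrite mulrDl !linearD /= IH IH' mulrDl.
rewrite pathalgMZl !linearZ_LR /= pathalgMZl; congr (_ *: _).
elim/pathalg_ind: g => [|g g' IH IH'|d q].
- by rewrite mulr0 linear0 mulr0.
- by rewrite mulrDr !linearD /= IH IH' mulrDr.
by rewrite pathalgMZr !linearZ_LR /= pathalgMZr old_partM_basis.
Qed.

(** Thus [new_part j] is a derivation twisted by [old_part] on the left and by the coefficient of
    the trivial path at [j] on the right. *)
Lemma new_partM j f g : new_part j (f * g) =
  old_part f * new_part j g + g@_(@ptriv Q' j) *: new_part j f.
Proof.
elim/pathalg_ind: f => [|f f' IH IH'|c p].
- by rewrite mul0r !linear0 mul0r addr0.
- by rewrite mulrDl !linearD /= IH IH' mulrDl addrACA.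
have newZ d h : new_part j (d *: h) = d *: new_part j h by apply: linearZ_LR.
rewrite pathalgMZl [old_part (_ *: _)]linearZ_LR pathalgMZl !newZ.
rewrite (scalerCA _ c) -scalerDr; congr (_ *: _).
elim/pathalg_ind: g => [|g g' IH IH'|d q].
- by rewrite mulr0 !linear0 mulr0 mcoeff0 scale0r addr0.
- by rewrite mulrDr !linearD /= IH IH' mulrDr mcoeffD scalerDl addrACA.
rewrite pathalgMZr !newZ pathalgMZr new_partM_basis scalerDr.
by rewrite mcoeffZ scalerA.
Qed.

Definition push : A -> A' := pathalg_ext (fun r => pbasis K (old r)).
HB.instance Definition _ := GRing.Linear.on push.

Lemma push_basis r : push (pbasis K r) = pbasis K (old r).
Proof. exact: pathalg_ext_basis. Qed.

Lemma pushM a b : push (a * b) = push a * push b.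
Proof.
elim/pathalg_ind: a => [|a a' IH IH'|c p].
- by rewrite mul0r linear0 mul0r.
- by rewrite mulrDl !linearD /= IH IH' mulrDl.
rewrite pathalgMZl !linearZ_LR /= pathalgMZl; congr (_ *: _).
elim/pathalg_ind: b => [|b b' IH IH'|d q].
- by rewrite mulr0 linear0 mulr0.
- by rewrite mulrDr !linearD /= IH IH' mulrDr.
rewrite pathalgMZr !linearZ_LR /= pathalgMZr; congr (_ *: _).
rewrite !push_basis !pbasisM pcomp_old.
by case: (pcomp p q) => [t|] /=; rewrite ?linear0 ?push_basis.
Qed.

Lemma pathalg1E (Q0 : quiver) :
  1 = \sum_(v : vertex Q0) pbasis K (ptriv v) :> pathalg K Q0.
Proof. by []. Qed.

Lemma old_triv (v : vertex Q) : old (ptriv v) = @ptriv Q' v.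
Proof. exact: qpath_eq. Qed.

Lemma push1 : push 1 = 1.
Proof.
rewrite !pathalg1E linear_sum; apply: eq_bigr => v _ /=.
by rewrite push_basis old_triv.
Qed.

Lemma pushK : cancel push (@old_part K Q).
Proof.
apply: (pathalg_linear_eq (u := @old_part K Q \o push) (v := idfun)) => r /=.
by rewrite push_basis; apply/pull_basis/old_inj.
Qed.

Lemma old_part1 : old_part (1 : A') = 1.
Proof. by rewrite -push1 pushK. Qed.

Lemma old_neq_new j (r s : qpath Q) : old r <> new j s.
Proof.
move=> /(congr1 (fun p => all (@isl Q) (parrows p))) /=.
by rewrite all_isl_map all_rcons.
Qed.

Lemma new_part_push j a : new_part j (push a) = 0.
Proof.
apply: (pathalg_linear_eq (u := @new_part K Q j \o push) (v := \0)) => r /=.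
by rewrite push_basis; apply: pull_basis0 => s /esym/old_neq_new.
Qed.

(** The element [x_j]: the sum of all new arrows ending at [j]. *)
Definition new_arrow j : A' := \sum_(i : vertex Q) pbasis K (new j (ptriv i)).

Lemma old_part_new_arrow j : old_part (new_arrow j) = 0.
Proof.
rewrite linear_sum big1 // => i _; apply: pull_basis0 => r.
exact: old_neq_new.
Qed.

Lemma new_part_new_arrow k j : new_part k (new_arrow j) = (k == j)%:R.
Proof.
rewrite linear_sum; case: eqVneq => [->|ne].
  rewrite pathalg1E; apply: eq_bigr => i _; exact/pull_basis/new_inj.
rewrite big1 // => i _; apply: pull_basis0 => r /(congr1 (@ptgt Q')).
by rewrite !ptgt_new => /eqP; rewrite (negbTE ne).
Qed.

Definition coord_map (k : option (vertex Q)) : {linear A' -> A} :=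
  if k is Some j then @new_part K Q j : {linear A' -> A} else @old_part K Q.

Definition basis_map (k : option (vertex Q)) : A' :=
  if k is Some j then new_arrow j else 1.

Lemma coord_map_push k a f : coord_map k (push a * f) = a * coord_map k f.
Proof.
case: k => [j|] /=; last by rewrite old_partM pushK.
by rewrite new_partM pushK new_part_push scaler0 addr0.
Qed.

Lemma coord_map_basis k l : coord_map k (basis_map l) = (k == l)%:R.
Proof.
case: k l => [i|] [j|] /=.
- exact: new_part_new_arrow.
- by rewrite -push1 new_part_push.
- exact: old_part_new_arrow.
- exact: old_part1.
Qed.

Section Ideal.
Variable I : ideal (pathalg K Q).
Hypothesis I_length : forall a, ideal_set I a -> length_ge 2 a.

(* A path outside the images of [old] and of all [new j], i.e. one with a new
   arrow before its last arrow, lies in this set. *)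
Definition ext_ideal_set : set A' :=
  fun f => ideal_set I (old_part f) /\ forall j, ideal_set I (new_part j f).

Lemma mcoeff_triv_ext f j : ideal_set I (old_part f) -> f@_(@ptriv Q' j) = 0.
Proof.
move=> /I_length If; rewrite -old_triv -(mcoeff_pull (@old_inj Q)).
exact: If.
Qed.

Lemma ext_ideal_subproof : is_ideal ext_ideal_set.
Proof.
have idI := idealP I; have [I0 IB IMl IMr] := idI.
split=> [|f g [If If'] [Ig Ig']|g f [If If']|g f [If If']].
- by split=> [|j]; rewrite linear0.
- split=> [|j]; rewrite linearB; first exact: IB.
  exact: IB (If' j) (Ig' j).
- split=> [|j]; first by rewrite old_partM; apply: IMl.
  (* The twisting term vanishes because elements of [I] have no trivial paths in their support. *)
  rewrite new_partM mcoeff_triv_ext // scale0r addr0.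
  exact: IMl (If' j).
- split=> [|j]; first by rewrite old_partM; apply: IMr.
  rewrite new_partM; apply: is_idealD => //; first exact: IMr.
  exact: is_idealZ (If' j).
Qed.

Definition ext_ideal : ideal A' := Ideal ext_ideal_subproof.

Lemma ext_idealP f :
  ideal_set ext_ideal f <-> forall k, ideal_set I (coord_map k f).
Proof.
split=> [[If If'] [j|]|If]; [exact: If'|exact: If|split=> [|j]].
- exact: (If None).
- exact: (If (Some j)).
Qed.

Lemma push_ideal a : ideal_set I a -> ideal_set ext_ideal (push a).
Proof.
move=> Ia; split=> [|j]; first by rewrite pushK.
by rewrite new_part_push; case: (idealP I).
Qed.

Lemma ext_ideal_admissible : admissible I -> admissible ext_ideal.
Proof.
(* The exponent grows by one because [new j r] is one arrow longer than [r]. *)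
move=> /admissibleP[n [le2n [JI _]]]; apply/admissibleP; exists n.+1.
split; first exact: leqW.
split=> [f fn|f [If If'] p].
  split=> [|j]; apply: JI => r lt; rewrite mcoeff_pull.
  - by apply: fn; rewrite /= size_map; apply: leqW.
  - exact: old_inj.
  - by apply: fn; rewrite /= size_rcons size_map.
  - exact: new_inj.
have [[r ->]|np] : (exists r, p = old r) \/ ~~ all (@isl Q) (parrows p).
  by case: (boolP (all _ _)) => [/oldP|]; [left|right].
  rewrite /= size_map -(mcoeff_pull (@old_inj Q)) => lt.
  exact: I_length lt.
(* A path of length below 2 that is not old is a single new arrow, that is [new ij.2] of a trivial
   path, whose coefficient in [new_part ij.2 f] is zero. *)
case ps: (parrows p) np => [|[a|ij] [|b s]] //= _ _.
have [r pr] := newP (p := p) (s := [::]) (ij := ij) isT ps.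
move: ps; rewrite pr -(mcoeff_pull (@new_inj Q ij.2)) => /(congr1 size) /=.
rewrite size_rcons size_map => -[r0].
by apply: (I_length (If' ij.2)); rewrite r0.
Qed.

End Ideal.
End ExtendedAlgebra.

Arguments coord_map {K Q} k.
Arguments basis_map {K Q} k.

(** * Passage to the quotient algebras *)

Section QuotientMap.
Variables (R R' : pzRingType) (I : ideal R) (I' : ideal R').
Variable u : {additive R -> R'}.

(** The map [u] is only additive, so that the coordinates [new_part], which are not multiplicative,
    are covered too. *)
Definition quot_map (x : quot_ring I) : quot_ring I' :=
  quot_pi I' (u (quot_repr x)).

Hypothesis uI : forall x, ideal_set I x -> ideal_set I' (u x).

Lemma quot_mapE x : quot_map (quot_pi I x) = quot_pi I' (u x).
Proof.
apply/quot_piE; rewrite -raddfB; apply: uI; apply/quot_piE.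
exact: quot_reprK.
Qed.

Lemma quot_mapD : {morph quot_map : x y / x + y}.
Proof.
move=> x y; rewrite -[x]quot_reprK -[y]quot_reprK -quot_piD !quot_mapE.
by rewrite raddfD quot_piD.
Qed.

End QuotientMap.

Lemma quot_pi_mul (R : pzRingType) (I : ideal R) (x y : R) :
  quot_pi I (x * y) = quot_pi I x * quot_pi I y.
Proof. exact: quot_piM. Qed.

Lemma quot_pi0 (R : pzRingType) (I : ideal R) : quot_pi I 0 = 0.
Proof. by apply: (addIr (quot_pi I 0)); rewrite -quot_piD !add0r. Qed.

Lemma quot_pi_sum (R : pzRingType) (I : ideal R) (T : Type) (r : seq T)
    (P : pred T) (F : T -> R) :
  quot_pi I (\sum_(i <- r | P i) F i) = \sum_(i <- r | P i) quot_pi I (F i).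
Proof. exact: (big_morph _ (@quot_piD _ I) (quot_pi0 I)). Qed.

Lemma quot_pi_bool (R : pzRingType) (I : ideal R) (c : bool) :
  quot_pi I c%:R = c%:R.
Proof. by case: c => //; apply: quot_pi0. Qed.

Section FreeExtension.
Variables (K : fieldType) (Q : quiver) (I : ideal (pathalg K Q)).
Hypothesis I_length : forall a, ideal_set I a -> length_ge 2 a.
Local Notation I' := (ext_ideal I_length).
Local Notation A := (quot_ring I).
Local Notation B := (quot_ring I').

(** Right modules are left modules over the converse ring, so the extension is between converse
    rings: [B], free as a left [A]-module, gives [B^c], free as a right [A^c]-module. *)
Definition quot_push : A^c -> B^c := quot_map I' (@push K Q).

Lemma quot_pushE a : quot_push (quot_pi I a) = quot_pi I' (push a).
Proof. by apply: quot_mapE => x; apply: push_ideal. Qed.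

Lemma quot_push_nmod_morphism : nmod_morphism quot_push.
Proof.
split; last by apply: quot_mapD => x; apply: push_ideal.
by have := quot_pushE 0; rewrite linear0 !quot_pi0.
Qed.

Lemma quot_push_monoid_morphism : monoid_morphism quot_push.
Proof.
split; first by have := quot_pushE 1; rewrite push1.
move=> x y; rewrite -[x]quot_reprK -[y]quot_reprK.
move: (quot_repr x) (quot_repr y) => f g.
(* In the converse ring the product of the classes of [f] and [g] is the class of [g * f]. *)
rewrite (quot_pushE f) (quot_pushE g); have := quot_pushE (g * f).
by rewrite pushM !quot_pi_mul => e; exact: e.
Qed.

HB.instance Definition _ :=
  Algebra.isNmodMorphism.Build A^c B^c quot_push quot_push_nmod_morphism.
HB.instance Definition _ :=
  GRing.isMonoidMorphism.Build A^c B^c quot_push quot_push_monoid_morphism.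

Definition quot_coord k : B^c -> A^c := quot_map I (coord_map k).

Lemma coord_map_ideal k f : ideal_set I' f -> ideal_set I (coord_map k f).
Proof. by move=> /ext_idealP. Qed.

Lemma quot_coordE k f : quot_coord k (quot_pi I' f) = quot_pi I (coord_map k f).
Proof. by apply: quot_mapE => x; apply: coord_map_ideal. Qed.

Definition quot_basis k : B^c := quot_pi I' (basis_map k).

Lemma quot_coordD k : {morph quot_coord k : s t / s + t}.
Proof. by apply: quot_mapD => x; apply: coord_map_ideal. Qed.

Lemma quot_coordM k s a : quot_coord k (s * quot_push a) = quot_coord k s * a.
Proof.
rewrite -[s]quot_reprK -[a]quot_reprK quot_pushE.
move: (quot_repr a) (quot_repr s) => g f.
rewrite (quot_coordE k f); have := quot_coordE k (push g * f).
by rewrite coord_map_push !quot_pi_mul => e; exact: e.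
Qed.

Lemma quot_coord_basis k l : quot_coord k (quot_basis l) = (k == l)%:R.
Proof. by rewrite quot_coordE coord_map_basis quot_pi_bool. Qed.

(** Upstairs the two sides agree only in their coordinates; their difference lies in [ext_ideal] by
    [ext_idealP]. *)
Lemma quot_decomp (s : B^c) :
  s = \sum_k quot_basis k * quot_push (quot_coord k s).
Proof.
rewrite -[s]quot_reprK; move: (quot_repr s) => f {s}.
transitivity (quot_pi I' (\sum_k push (coord_map k f) * basis_map k)).
  apply/quot_piE/ext_idealP => l.
  rewrite linearB linear_sum (bigD1 l) //= big1 => [|k kl].
    rewrite coord_map_push coord_map_basis eqxx mulr1 addr0 subrr.
    by case: (idealP I).
  by rewrite coord_map_push coord_map_basis eq_sym (negbTE kl) mulr0.
rewrite quot_pi_sum; apply: eq_bigr => k _.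
by rewrite quot_coordE quot_pushE quot_pi_mul.
Qed.

Lemma quot_basis1 : quot_basis None = 1.
Proof. by []. Qed.

(** The projection [old_part] is multiplicative, fixes 1 and kills every [new_arrow], hence is
    linear on this side as well. *)
Lemma quot_coord1 a k :
  quot_coord None (quot_push a * quot_basis k) = (k == None)%:R * a.
Proof.
rewrite -[a]quot_reprK quot_pushE; move: (quot_repr a) => f.
have := quot_coordE None (basis_map k * push f).
have old_basis : old_part (basis_map k) = (k == None)%:R :> pathalg K Q.
  by rewrite eq_sym; apply: (coord_map_basis K None k).
rewrite /= old_partM pushK old_basis.
rewrite !quot_pi_mul quot_pi_bool => e; apply: etrans e _.
exact: (esym (@commr_nat A (quot_pi I f) (k == None))).
Qed.

Definition quot_free_extension : free_extension A^c B^c :=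
  FreeExtension quot_coordD quot_coordM quot_coord_basis quot_decomp
    quot_basis1 quot_coord1.

End FreeExtension.

(** * Transfer of the bound on the finitistic dimension *)

Lemma finite_findimP (A : pzRingType) : finite_findim A <->
  exists d, forall (M : rmodType A) n,
    finitely_generated M -> projdim M n -> (n <= d)%N.
Proof.
split=> [[d [ub _]]|[d bound]].
  by exists d => M n fgM Mn; apply: (ub n); exists M.
(* Any bound yields a least one, which is the required supremum. *)
pose p k := `[< forall n, findim_set A n -> (n <= k)%N >].
have ex : exists k, p k.
  by exists d; apply/asboolP => n [M [fgM Mn]]; apply: bound Mn.
case: (ex_minnP ex) => m /asboolP ub min; exists m; split=> [n /ub //|k kub].
by apply: min; apply/asboolP => n /kub.
Qed.

Theorem theorem6p1 (K : fieldType) :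
  (forall (Q : quiver) (I : ideal (pathalg K Q)),
     path_connected Q -> admissible I -> finite_findim (quot_ring I)) ->
  forall (Q : quiver) (I : ideal (pathalg K Q)),
    admissible I -> finite_findim (quot_ring I).
Proof.
move=> finQ Q I admI.
have [_ [_ [_ I_length]]] := (admissibleP I).1 admI.
have /finite_findimP[d bound] := finQ _ (ext_ideal I_length)
  (@ext_quiver_connected Q) (ext_ideal_admissible I_length admI).
apply/finite_findimP; exists d => M n.
exact: (base_change_findim (quot_free_extension I_length) bound).
Qed.
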